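(* Let $(\Omega,\mathcal F,P)$ be an atomless probability space and let $X,Y\in\mathcal L_1(\Omega,\mathcal F,P)$. Then the optimal value of the problem $$\inf_{Z\in \mathcal L_1(\Omega,\mathcal F,P)}\ W_1(X,Z)\quad\text{s.t. } Z\succeq_{(2)}Y,\ \ Z\succeq_{(1)}X,$$ that is, the distance $\operatorname{dist}(X,A_2(Y))$, satisfies $$\operatorname{dist}(X,A_2(Y))=\max\Big(0,\sup_{p\in(0,1]}\big(F^{(-2)}_Y(p)-F^{(-2)}_X(p)\big)\Big)=\max\Big(0,\sup_{\eta\in\mathbb R}\big(F^{(2)}_X(\eta)-F^{(2)}_Y(\eta)\big)\Big).$$
   Context: $\mathcal L_1(\Omega,\mathcal F,P)$ is the space of integrable real random variables. For a random variable $Z$: $F_Z(\eta)=P(Z\le\eta)$; $F_Z^{(-1)}(p)=\inf\{\eta: F_Z(\eta)\ge p\}$ for $p\in(0,1)$; for integrable $Z$, $F_Z^{(2)}(\eta)=\int_{-\infty}^\eta F_Z(t)\,dt=\mathbb E[\max(\eta-Z,0)]$ for $\eta\in\mathbb R$; $F_Z^{(-2)}(p)=\int_0^pF_Z^{(-1)}(t)\,dt$ for $0<p\le1$ and $F_Z^{(-2)}(0)=0$. First-order stochastic dominance: $Z\succeq_{(1)}X$ iff $F_Z(\eta)\le F_X(\eta)$ for all $\eta\in\mathbb R$ (equivalently $F_Z^{(-1)}(p)\ge F_X^{(-1)}(p)$ for all $p\in(0,1)$). Second-order stochastic dominance: $Z\succeq_{(2)}Y$ iff $F_Z^{(2)}(\eta)\le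 F_Y^{(2)}(\eta)$ for all $\eta\in\mathbb R$ (equivalently $F_Z^{(-2)}(p)\ge F_Y^{(-2)}(p)$ for all $p\in[0,1]$). $A_2(Y)=\{Z\in\mathcal L_1(\Omega,\mathcal F,P): Z\succeq_{(2)}Y\}$. The Monge–Kantorovich (Wasserstein) distance of order 1 is $W_1(X,Z)=\int_0^1|F_Z^{(-1)}(p)-F_X^{(-1)}(p)|\,dp$, and $\operatorname{dist}(X,A_2(Y))=\inf\{W_1(X,Z): Z\in A_2(Y)\}$. *)

(* Defs.v *)
From HB Require Import structures.
From mathcomp Require Import all_boot all_order all_algebra.
From mathcomp Require Import all_classical all_reals all_analysis.

Set Implicit Arguments.
Unset Strict Implicit.
Unset Printing Implicit Defensive.
Import Order.TTheory GRing.Theory Num.Theory.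
Import numFieldNormedType.Exports.

Local Open Scope classical_set_scope.
Local Open Scope ring_scope.
Local Open Scope ereal_scope.

Definition atomless (d : measure_display) (T : measurableType d) (R : realType)
    (P : probability T R) : Prop :=
  forall A : set T, measurable A -> 0 < P A ->
    exists B : set T, [/\ measurable B, B `<=` A, 0 < P B & P B < P A].

Section StochasticDominance.
Context {d : measure_display} {T : measurableType d} {R : realType}
  {P : probability T R}.
Implicit Types X Y Z : {RV P >-> R}.

Definition L1 : set {RV P >-> R} := [set Z | (Z : T -> R) \in Lfun P 1].

(* The real-valued [inf] is the genuine infimum for 0 < p < 1, where the set is
   nonempty and bounded below; no other p is used below. *)
Definition quantile Z (p : R) : R := inf [set eta : R | p%:E <= cdf Z eta].

(* F_Z^(2), valued in [0, +oo]; finite when Z is integrable. *)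
Definition icdf Z (eta : R) : \bar R :=
  \int[lebesgue_measure]_(t in `]-oo, eta]) cdf Z t.

(* F_Z^(-2), finite on [0, 1] when Z is integrable. The open interval keeps the
   meaningless value of the quantile at 1 out of the case p = 1, and yields 0
   at p = 0. *)
Definition iquantile Z (p : R) : \bar R :=
  \int[lebesgue_measure]_(t in `]0%R, p[) (quantile Z t)%:E.

Definition fosd Z X : Prop := forall eta : R, cdf Z eta <= cdf X eta.

Definition sosd Z Y : Prop := forall eta : R, icdf Z eta <= icdf Y eta.

Definition A2 Y : set {RV P >-> R} := [set Z | L1 Z /\ sosd Z Y].

Definition W1 X Z : \bar R :=
  \int[lebesgue_measure]_(p in `]0%R, 1%R[)
    (`|quantile Z p - quantile X p|%R)%:E.

Definition dist X (A : set {RV P >-> R}) : \bar R :=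
  ereal_inf [set W1 X Z | Z in A].

End StochasticDominance.

(* Main.v *)
Require Import Defs.
From HB Require Import structures.
From mathcomp Require Import all_boot all_order all_algebra.
From mathcomp Require Import all_classical all_reals all_analysis.
From mathcomp Require Import measurable_realfun lra.

Set Implicit Arguments.
Unset Strict Implicit.
Unset Printing Implicit Defensive.
Import Order.TTheory GRing.Theory Num.Theory.
Import numFieldNormedType.Exports.

Local Open Scope classical_set_scope.
Local Open Scope ring_scope.
Local Open Scope ereal_scope.

(** Write q_X for the quantile function of X. Since q_X has, under Lebesgue
    measure on (0, 1), the law of X, F_X^(2)(eta) is the integral over (0, 1)
    of (eta - q_X)^+. Hence |F_X^(2)(eta) - F_Z^(2)(eta)| <= W_1(X, Z), which
    bounds the distance from below by M, the positive part of the supremum of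
    F_X^(2) - F_Y^(2). If M > 0, choose c with F_X^(2)(c) = M, by continuity.
    Then Z = max(X, c) dominates X to the first order; F_Z^(2) is 0 below c and
    F_X^(2) - M <= F_Y^(2) from c on, so Z dominates Y to the second order; and
    W_1(X, Z) = F_X^(2)(c) = M since q_Z = max(q_X, c). Finally F^(2) and F^(-2)
    are Fenchel conjugates, which identifies the two suprema. *)

(** * Quantile function as generalized inverse of the cdf *)

Section Quantile.
Context {d : measure_display} {T : measurableType d} {R : realType}
  {P : probability T R}.
Variable X : {RV P >-> R}.
Implicit Types p x : R.

(** The set is nonempty because the cdf tends to 1 > p at +oo, and bounded below because it tends to
    0 < p at -oo. *)
Let has_inf_quantile p : (0 < p < 1)%R ->
  has_inf [set eta : R | p%:E <= cdf X eta].
Proof.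
move=> /andP[p0 p1]; split.
  apply: contrapT => F_lt.
  suff : 1 <= p%:E by rewrite lee_fin leNgt p1.
  apply: cvge_le (@cvg_cdfy1 _ _ _ _ X); apply: nearW => x.
  by apply/ltW; rewrite ltNge; apply/negP => Fx; apply: F_lt; exists x.
apply: contrapT => F_ge.
suff : p%:E <= 0 by rewrite lee_fin leNgt p0.
apply: cvge_ge (@cvg_cdfNy0 _ _ _ _ X); apply: nearW => x.
rewrite leNgt; apply/negP => Fx; apply: F_ge; exists x => y /= Fy.
rewrite leNgt; apply/negP => yx.
have := lt_le_trans Fx Fy; rewrite ltNge => /negP; apply.
exact/cdf_nondecreasing/ltW.
Qed.

(** Galois connection between quantile and cdf: right continuity of the cdf puts the infimum itself
    in the set, and monotonicity does the rest. *)
Lemma quantile_le p x : (0 < p < 1)%R ->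
  (quantile X p <= x)%R = (p%:E <= cdf X x).
Proof.
move=> p01; have hinf := has_inf_quantile p01; apply/idP/idP => [qx|Fx].
  apply: le_trans (cdf_nondecreasing X qx).
  apply: cvge_ge (@cdf_right_continuous _ _ _ _ X (quantile X p)).
  near=> y; have : (0 < y - quantile X p)%R.
    by rewrite subr_gt0; near: y; exact: nbhs_right_gt.
  move=> /inf_adherent/(_ hinf)[e Fe]; rewrite subrKC => ey.
  by apply: (le_trans Fe); exact/cdf_nondecreasing/ltW.
by apply: ge_inf => //; case: hinf.
Unshelve. all: end_near. Qed.

Lemma cdf_quantile p : (0 < p < 1)%R -> p%:E <= cdf X (quantile X p).
Proof. by move=> p01; rewrite -quantile_le. Qed.

Lemma quantile_homo :
  {in `]0%R, 1%R[ &, {homo quantile X : p r / (p <= r)%R}}.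
Proof.
move=> p r p01 r01 pr; rewrite quantile_le//.
by apply: le_trans (cdf_quantile r01); rewrite lee_fin.
Qed.

Lemma measurable_quantile :
  measurable_fun (`]0%R, 1%R[%classic : set R) (quantile X).
Proof.
apply: (measurability (@RGenCInfty.G R)) => [|/= _ [_] [r] -> <-].
  exact: RGenCInfty.measurableE.
(* By monotonicity on (0, 1), the preimage of a ray is an interval. *)
apply: is_interval_measurable => s t /= [s01 rs] [t01 rt] u /andP[su ut].
have u01 : u \in `]0%R, 1%R[.
  move: s01 t01; rewrite /= !in_itv/= => /andP[s0 _] /andP[_ t1].
  by rewrite (lt_le_trans s0)//= (le_lt_trans ut).
split => //; move: rs; rewrite /= !in_itv/= !andbT => /le_trans; apply.
exact: quantile_homo.
Qed.

End Quantile.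

(** * Law of the quantile function under the uniform distribution *)

Section QuantileLaw.
Context {d : measure_display} {T : measurableType d} {R : realType}
  {P : probability T R}.
Variable X : {RV P >-> R}.
Local Notation mu := (@lebesgue_measure R).

(** The intervals ]a, b] are stable under intersection, generate the Borel sets, and have as measure
    a difference of two cdf values. *)
Lemma eq_probability_cdf (P1 P2 : probability R R) :
  (forall x : R, P1 `]-oo, x]%classic = P2 `]-oo, x]%classic) ->
  forall A : set R, measurable A -> P1 A = P2 A.
Proof.
move=> P12; apply: (measure_unique (@ocitv R)
  (fun n => `](- n%:R)%R, n%:R]%classic)) => //.
- exact: ocitvI.
- by move=> n; exact: is_ocitv.
- exact: bigcup_itvT.
- move=> I [[a b] _ <-]/=.
  have -> : `]a, b]%classic = `]-oo, b] `\` `]-oo, a].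
    by rewrite -[RHS]setCK setCD setCitvl setUC -[LHS]setCK setCitv.
  have [ab|ba] := leP a b; last first.
    rewrite (_ : _ `\` _ = set0) ?measure0//; apply/seteqP.
    split => // x [/=].
    by rewrite !in_itv/= => xb /negP; rewrite (le_trans xb (ltW ba)).
  rewrite !measureD//= ?setIidr; try exact: subset_itvl.
  by rewrite !P12.
  1,2: by rewrite -ge0_fin_numE ?fin_num_measure.
- by move=> n; rewrite -ge0_fin_numE ?fin_num_measure.
Qed.

(** Extension by 0 outside (0, 1), so as to have a random variable on the whole line; the uniform
    law [U] does not see the added values. *)
Let Q : measurableTypeR R -> R := quantile X \_ (`]0%R, 1%R[%classic : set R).

Let measurable_Q : measurable_fun [set: measurableTypeR R] Q.
Proof.
by apply/(measurable_restrictT _ _).1 => //; exact: measurable_quantile.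
Qed.

HB.instance Definition _ := isMeasurableFun.Build _ _ _ _ Q measurable_Q.

Let U : probability (measurableTypeR R) R := uniform_prob (@ltr01 R).

Let integral_U (f : R -> \bar R) : measurable_fun [set: R] f ->
    (forall x, 0 <= f x) ->
  \int[U]_x f x = \int[mu]_(x in `]0%R, 1%R[) f x.
Proof.
move=> mf f0; rewrite integral_uniform// subr0 invr1 mul1e.
by rewrite integral_itv_bndoo//; exact: measurable_funS mf.
Qed.

(** Inverse transform: by [quantile_le], inside (0, 1) the event Q <= x is p <= F_X(x), which has
    length F_X(x). *)
Let distribution_Q (A : set R) : measurable A ->
  distribution U Q A = distribution P X A.
Proof.
move: A; apply: eq_probability_cdf => x.
rewrite -[LHS]/(U (Q @^-1` `]-oo, x]%classic)) -[RHS]/(cdf X x).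
have mA : measurable (Q @^-1` `]-oo, x]).
  by rewrite -[_ @^-1` _]setTI; exact: measurable_Q.
rewrite -[Q @^-1` _]setIT -integral_indic// integral_U//; last first.
  exact/measurable_EFinP/measurable_indic.
rewrite integral_indic//.
have Ffin : cdf X x \is a fin_num by rewrite fin_num_measure.
rewrite -(fineK Ffin); set F := fine _.
have F0 : (0 <= F)%R by exact: fine_ge0.
have F1 : (F <= 1)%R by rewrite -lee_fin fineK// cdf_le1.
have QF p : (0 < p < 1)%R -> (Q p <= x)%R = (p <= F)%R.
  by move=> p01; rewrite /Q patchE mem_set//= quantile_le// -(fineK Ffin).
(* If F = 1 the event is ]0, 1[ rather than ]0, F], so this case is measured apart. *)
move: F1; rewrite le_eqVlt => /predU1P[F1|F1].
  transitivity (mu (`]0%R, 1%R[%classic : set R)); last first.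
    by rewrite lebesgue_measure_itv/= lte_fin ltr01 F1 oppr0 adde0.
  congr (mu _); apply/seteqP; split => p /=; first by case.
  rewrite !in_itv/= => p01.
  by split => //; rewrite QF// F1; case/andP : p01 => _ /ltW.
transitivity (mu (`]0%R, F]%classic : set R)); last first.
  rewrite lebesgue_measure_itv/= lte_fin; case: ltP => [_|F0'].
    by rewrite oppr0 adde0.
  by congr EFin; apply/eqP; rewrite eq_le F0 F0'.
congr (mu _); apply/seteqP; split => p /=; rewrite !in_itv/=.
  by move=> [Qp p01]; rewrite -QF// Qp andbT; case/andP : p01.
move=> /andP[p0 pF]; have p01 : (0 < p < 1)%R by rewrite p0 (le_lt_trans pF).
by rewrite QF.
Qed.

(** Change of variables through the common law of [X] and [Q]. It moves expectations to (0, 1),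
    where different variables are compared pointwise through their quantile functions. *)
Lemma ge0_integral_quantile (f : R -> \bar R) : measurable_fun [set: R] f ->
    (forall x, 0 <= f x) ->
  \int[mu]_(p in `]0%R, 1%R[) f (quantile X p) = \int[P]_w f (X w).
Proof.
move=> mf f0; rewrite -[RHS](@ge0_integral_distribution _ _ _ _ _ P X)//.
transitivity (\int[distribution U Q]_y f y); last first.
  by apply: eq_measure_integral => A mA _; exact: distribution_Q.
have mfQ : measurable_fun [set: R] (f \o Q) by exact: measurableT_comp.
have fQ0 x : 0 <= (f \o Q) x by exact: f0.
rewrite ge0_integral_distribution// integral_U//.
by apply: eq_integral => p p01; rewrite /= /Q patchE p01.
Qed.

End QuantileLaw.

(** * The integrated cdf as an expected shortfall *)

Section IntegratedCdf.
Context {d : measure_display} {T : measurableType d} {R : realType}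
  {P : probability T R}.
Variable X : {RV P >-> R}.
Local Notation mu := (@lebesgue_measure R).

(** Tonelli on the region X w <= t <= eta: its section at t <= eta has probability F_X(t), its
    section at w has length (eta - X w)^+. *)
Lemma icdf_expectation (eta : R) :
  icdf X eta = \int[P]_w (Num.max (eta - X w) 0)%:E.
Proof.
pose A : set (measurableTypeR R * T) :=
  [set z | (X z.2 <= z.1)%R && (z.1 <= eta)%R].
have mA : measurable A.
  have mX : measurable_fun [set: measurableTypeR R * T] (fun z => X z.2).
    exact: measurableT_comp.
  have m1 : measurable_fun [set: measurableTypeR R * T] (fun z => z.1 : R).
    exact: measurable_fst.
  have mb : measurable_fun [set: measurableTypeR R * T]
      (fun z => (X z.2 <= z.1)%R && (z.1 <= eta)%R).
    by apply: measurable_and; apply: measurable_fun_ler.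
  by have := mb measurableT [set true] I; rewrite setTI.
have A_itv t w : \1_A (t, w) = \1_(`[X w, eta]%classic : set R) t :> R.
  by rewrite !indicE; congr ((nat_of_bool _)%:R).
transitivity (\int[mu]_t \int[P]_w (\1_A (t, w))%:E).
  rewrite /icdf integral_mkcond; apply: eq_integral => t _; rewrite patchE.
  case: ifPn => [|]; rewrite ?inE ?notin_setE /= in_itv/= => tle.
    rewrite -[cdf X t]/(P (X @^-1` `]-oo, t]%classic)) -[X in P X]setIT.
    rewrite -integral_indic//; last first.
      by rewrite -[_ @^-1` _]setTI; exact: measurable_funP.
    apply: eq_integral => w _.
    rewrite A_itv !indicE; congr (((nat_of_bool _)%:R)%:E).
    by apply/idP/idP; rewrite !inE/= !in_itv/= tle andbT.
  apply: esym; apply: integral0_eq => w _.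
  rewrite A_itv indicE memNset//= in_itv/=.
  by move=> /andP[].
rewrite (fubini_tonelli (fun z => (\1_A z)%:E))//; last first.
  exact/measurable_EFinP/measurable_indic.
apply: eq_integral => w _; under eq_integral do rewrite A_itv.
rewrite integral_indic// setIT -[LHS]/(mu (`[X w, eta]%classic : set R)).
rewrite lebesgue_measure_itv/= lte_fin.
case: ltP => [Xe|eX]; first by rewrite max_l// subr_ge0 ltW.
by rewrite max_r// subr_le0.
Qed.

Lemma icdf_quantile (eta : R) :
  icdf X eta = \int[mu]_(p in `]0%R, 1%R[) (Num.max (eta - quantile X p) 0)%:E.
Proof.
rewrite icdf_expectation; apply/esym.
apply: (@ge0_integral_quantile _ _ _ _ X (fun x => (Num.max (eta - x) 0)%:E)).
  by apply/measurable_EFinP/measurable_maxr => //; exact: measurable_funB.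
by move=> x; rewrite lee_fin le_max lexx orbT.
Qed.

Lemma integrable_quantile : L1 X ->
  mu.-integrable `]0%R, 1%R[ (EFin \o quantile X).
Proof.
move=> /Lfun1_integrable/integrableP[_ iX]; apply/integrableP; split.
  by apply/measurable_EFinP; exact: measurable_quantile.
rewrite (@ge0_integral_quantile _ _ _ _ X (fun x => `|x%:E|))//.
exact: measurableT_comp.
Qed.

End IntegratedCdf.

(** * Fenchel duality between F^(2) and F^(-2) *)

Section Duality.
Context {d : measure_display} {T : measurableType d} {R : realType}
  {P : probability T R}.
Implicit Types (X Y Z : {RV P >-> R}) (p eta : R).
Local Notation mu := (@lebesgue_measure R).

Lemma measurable_quantile_excess X eta :
  measurable_fun (`]0%R, 1%R[%classic : set R)
    (fun p => (Num.max (eta - quantile X p) 0)%:E).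
Proof.
apply/measurable_EFinP/measurable_maxr => //; apply: measurable_funB => //.
exact: measurable_quantile.
Qed.

Lemma integrable_quantile_itv X p : L1 X -> (p <= 1)%R ->
  mu.-integrable `]0%R, p[ (EFin \o quantile X).
Proof.
move=> hX p1; apply: integrableS (integrable_quantile hX) => //.
by apply: subset_itvl; rewrite bnd_simp.
Qed.

Lemma integrable_cst_itv p eta : mu.-integrable `]0%R, p[ (EFin \o cst eta).
Proof.
rewrite -[EFin \o _]/(cst eta%:E); apply/integrableP; split => //.
rewrite integral_cst//= lebesgue_measure_itv/=.
by case: ifP => _; rewrite ?mule0 ?ltry// -EFinD -EFinM ltry.
Qed.

Lemma integrable_sub_quantile X p eta : L1 X -> (p <= 1)%R ->
  mu.-integrable `]0%R, p[ (EFin \o (fun t => eta - quantile X t)%R).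
Proof.
move=> hX p1; apply: (@integrableB _ (measurableTypeR R) _ _ _ _
  (EFin \o cst eta) (EFin \o quantile X)) => //.
  exact: integrable_cst_itv.
exact: integrable_quantile_itv.
Qed.

Lemma integrable_quantile_excess X eta : L1 X ->
  mu.-integrable `]0%R, 1%R[
    (EFin \o (fun t => Num.max (eta - quantile X t) 0)%R).
Proof.
move=> hX.
apply: le_integrable (integrable_sub_quantile eta hX (lexx 1%R)) => //.
  exact: measurable_quantile_excess.
move=> t _; rewrite /= lee_fin ger0_norm ?le_max ?lexx ?orbT//.
by rewrite ge_max normr_ge0 ler_norm.
Qed.

Lemma icdfE X eta : L1 X ->
  icdf X eta =
    (\int[mu]_(p in `]0%R, 1%R[) Num.max (eta - quantile X p) 0)%R%:E.
Proof.
move=> hX; rewrite icdf_quantile /Rintegral fineK//.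
apply: integrable_fin_num => //; exact: integrable_quantile_excess.
Qed.

Lemma iquantileE X p : L1 X -> (p <= 1)%R ->
  iquantile X p = (\int[mu]_(t in `]0%R, p[) quantile X t)%R%:E.
Proof.
move=> hX p1; rewrite /iquantile /Rintegral fineK//.
by apply: integrable_fin_num => //; exact: integrable_quantile_itv.
Qed.

Lemma Rintegral_cst_itv p eta : (0 <= p)%R ->
  (\int[mu]_(t in `]0%R, p[) eta)%R = (p * eta)%R.
Proof.
move=> p0; rewrite Rintegral_cst//= lebesgue_measure_itv/= lte_fin mulrC.
case: ltP => [_|p0']; first by rewrite /= oppr0 addr0.
by rewrite /= (@le_anti _ _ p 0%R) ?p0 ?p0'.
Qed.

(** Integrate eta - q_X <= (eta - q_X)^+ over (0, p), then enlarge the domain of the non-negative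
    right-hand side to (0, 1). *)
Lemma fenchel_young X p eta : L1 X -> (0 < p <= 1)%R ->
  (p * eta)%:E <= icdf X eta + iquantile X p.
Proof.
move=> hX /andP[p0 p1]; rewrite icdfE// iquantileE// -EFinD lee_fin.
have iq := integrable_quantile_itv hX p1.
have ie := integrable_quantile_excess eta hX.
have sub : `]0%R, p[ `<=` (`]0%R, 1%R[ : set R).
  by apply: subset_itvl; rewrite bnd_simp.
have iep : mu.-integrable `]0%R, p[
    (EFin \o (fun t => Num.max (eta - quantile X t) 0)%R).
  exact: integrableS ie.
rewrite -lerBlDr -(Rintegral_cst_itv eta (ltW p0)).
rewrite -RintegralB//; last exact: integrable_cst_itv.
apply: (@le_trans _ _
  (\int[mu]_(t in `]0%R, p[) Num.max (eta - quantile X t) 0)%R).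
  apply: le_Rintegral => //.
  - exact: integrable_sub_quantile.
  - by move=> t _; rewrite le_max lexx.
rewrite -lee_fin /Rintegral !fineK.
2,3: by [exact: integrable_fin_num iep|exact: integrable_fin_num ie].
apply: ge0_subset_integral => //; first exact: measurable_int ie.
by move=> t _; rewrite lee_fin le_max lexx orbT.
Qed.

(** The two conditions make (eta - q_X)^+ equal to eta - q_X up to p and to 0 beyond, so both
    inequalities behind [fenchel_young] become equalities. *)
Lemma fenchel_young_eq X p eta : L1 X -> (0 < p <= 1)%R ->
    {in `]0%R, 1%R[, forall t, (t <= p)%R -> (quantile X t <= eta)%R} ->
    {in `]0%R, 1%R[, forall t, (p < t)%R -> (eta <= quantile X t)%R} ->
  icdf X eta + iquantile X p = (p * eta)%:E.
Proof.
move=> hX /andP[p0 p1] qle qge; rewrite icdfE// iquantileE// -EFinD.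
have iq := integrable_quantile_itv hX p1.
congr EFin; apply/eqP; rewrite eq_sym -subr_eq; apply/eqP.
rewrite -(Rintegral_cst_itv eta (ltW p0)) -RintegralB//; last first.
  exact: integrable_cst_itv.
transitivity (\int[mu]_(t in `]0%R, 1%R[ `&` `]0%R, p])
  (eta - quantile X t))%R.
  (* The boolean side of the upper bound covers both cases at once: open at p = 1, closed at p <
     1. *)
  rewrite (_ : _ `&` _ = [set` Interval (BRight 0%R) (BSide (1 <= p)%R p)]).
    case: (leP 1%R p) => // p1'; rewrite Rintegral_itv_bndo_bndc//.
    exact: integrable_sub_quantile.
  apply/seteqP; split => t /=; rewrite !in_itv/=; case: (leP 1%R p) => p1' /=.
  - have -> : p = 1%R by apply/eqP; rewrite eq_le p1 p1'.
    by move=> [].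
  - by move=> [_].
  - have -> : p = 1%R by apply/eqP; rewrite eq_le p1 p1'.
    by move=> /andP[-> t1]; rewrite t1 (ltW t1).
  - by move=> /andP[-> tp]; rewrite tp (le_lt_trans tp).
rewrite Rintegral_mkcondr; apply: eq_Rintegral => t; rewrite inE => t01.
rewrite patchE; case: ifPn; rewrite ?inE ?notin_setE/= in_itv/=.
  by move=> /andP[t0 tp]; rewrite max_l// subr_ge0 qle.
move=> /negP; rewrite negb_and -!ltNge; case: (ltP p t) => [pt _|tp].
  by rewrite max_r// subr_le0 qge.
by move: t01; rewrite /= in_itv/= => /andP[->].
Qed.

End Duality.

(** * Limits, continuity and range of F^(2) *)

Section Tails.
Context {d : measure_display} {T : measurableType d} {R : realType}
  {P : probability T R}.
Implicit Types (X Y Z : {RV P >-> R}) (p eta e : R).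
Local Notation mu := (@lebesgue_measure R).

(** Dominated convergence with bound |g|: at each t the integrand vanishes as soon as n >= g t. *)
Lemma cvg_integral_excess (D : set R) (g : R -> R) : measurable D ->
  mu.-integrable D (EFin \o g) ->
  \int[mu]_(t in D) (Num.max (g t - n%:R) 0)%:E @[n --> \oo] --> 0.
Proof.
move=> mD ig; have mg : measurable_fun D g.
  by apply/measurable_EFinP; exact: measurable_int ig.
rewrite [X in _ --> X](_ : 0 = \int[mu]_(t in D) (cst 0 t)); last first.
  by rewrite integral0.
apply: (@dominated_cvg _ _ _ mu D mD _ _ (fun t => `|g t|%:E)) => //.
- move=> n; apply/measurable_EFinP/measurable_maxr => //.
  exact: measurable_funB.
- move=> t _; apply: cvg_near_cst; near=> n.
  rewrite max_r// subr_le0; near: n; exact: nbhs_infty_ger.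
- exact: (integrable_abse ig).
- move=> n t _; rewrite lee_fin ger0_norm ?le_max ?lexx ?orbT//.
  rewrite ge_max normr_ge0 andbT lerBlDr (le_trans (ler_norm _))//.
  by rewrite lerDl.
Unshelve. all: end_near. Qed.

Lemma integral_excess_small (D : set R) (g : R -> R) e : measurable D ->
    mu.-integrable D (EFin \o g) -> (0 < e)%R ->
  exists n, \int[mu]_(t in D) (Num.max (g t - n%:R) 0)%:E <= e%:E.
Proof.
move=> mD ig e0; apply: contrapT => excess_gt.
suff : e%:E <= 0 by rewrite lee_fin leNgt e0.
apply: cvge_ge (cvg_integral_excess mD ig); apply: nearW => n.
by apply/ltW; rewrite ltNge; apply/negP => le_e; apply: excess_gt; exists n.
Qed.

(** At eta = -n the integrand (eta - q_X)^+ is the excess of -q_X over n, whose integral tends to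
    0. *)
Lemma icdf_small X e : L1 X -> (0 < e)%R -> exists eta, icdf X eta <= e%:E.
Proof.
move=> hX e0.
have iNq : mu.-integrable `]0%R, 1%R[ (EFin \o (fun t => - quantile X t)%R).
  apply: (@integrableN _ (measurableTypeR R) _ _ _ (EFin \o quantile X)).
  exact: integrable_quantile.
have [//|n le_e] := integral_excess_small _ iNq e0.
exists (- n%:R)%R; rewrite icdf_quantile; apply: le_trans le_e.
by under eq_integral do rewrite addrC.
Qed.

(* At p = 1 the supremum of [p * eta - icdf X eta] need not be attained, whence
   the slack [e]. *)
Lemma fenchel_young_approx X p e : L1 X -> (0 < p <= 1)%R -> (0 < e)%R ->
  exists eta, icdf X eta + iquantile X p <= (p * eta + e)%:E.
Proof.
move=> hX /andP[p0]; rewrite le_eqVlt => /predU1P[->|p1] e0; last first.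
  have p01 : p \in `]0%R, 1%R[ by rewrite in_itv/= p0.
  exists (quantile X p); rewrite fenchel_young_eq ?p0 ?(ltW p1)//.
  - by rewrite lee_fin lerDl ltW.
  - by move=> t t01; exact: quantile_homo.
  - by move=> t t01 /ltW; exact: quantile_homo.
have iq := integrable_quantile hX.
have [//|n le_e] := integral_excess_small _ iq e0; exists n%:R.
rewrite icdf_quantile -integralD_EFin//; last first.
  exact: integrable_quantile_excess.
(* At eta = n, (n - q)^+ + q = n + (q - n)^+, and n was chosen so that the last term has integral at
   most e. *)
rewrite (eq_integral
    (fun t : measurableTypeR R =>
       (cst n%:R%:E t) + (Num.max (quantile X t - n%:R) 0)%:E)).
  rewrite ge0_integralD//=.
  - rewrite integral_cst//= lebesgue_measure_itv/= lte_fin ltr01.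
    by rewrite oppr0 adde0 mule1 mul1r EFinD leeD2l.
  - by move=> t _; rewrite lee_fin le_max lexx orbT.
  - apply/measurable_EFinP/measurable_maxr => //; apply: measurable_funB => //.
    exact: measurable_quantile.
move=> t _; rewrite -EFinD; congr EFin => /=.
by case: (leP (n%:R - quantile X t)%R);
  case: (leP (quantile X t - n%:R)%R); lra.
Qed.

(** At p = 1 the Fenchel-Young inequality bounds F_X^(2)(eta) from below by eta minus the mean of
    X. *)
Lemma icdf_unbounded X v : L1 X -> exists eta0,
  forall eta, (eta0 <= eta)%R -> v%:E <= icdf X eta.
Proof.
move=> hX; exists (v + fine (iquantile X 1))%R => eta.
have := @fenchel_young _ _ _ _ X 1 eta hX; rewrite ltr01 lexx => /(_ isT).
rewrite icdfE// iquantileE//= -EFinD !lee_fin mul1r; lra.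
Qed.

(** The positive part is 1-Lipschitz, and (0, 1) has length 1. *)
Lemma icdf_lipschitz X eta1 eta2 : L1 X ->
  (fine (icdf X eta1) <= fine (icdf X eta2) + `|eta1 - eta2|)%R.
Proof.
move=> hX; rewrite !icdfE//=.
rewrite -[X in (_ + X)%R]mul1r -(Rintegral_cst_itv `|eta1 - eta2|%R ler01).
rewrite -RintegralD//; last 2 first.
- exact: integrable_quantile_excess.
- exact: integrable_cst_itv.
apply: le_Rintegral => //.
- exact: integrable_quantile_excess.
- apply: (@integrableD _ (measurableTypeR R) _ _ _ _
    (EFin \o (fun t => Num.max (eta2 - quantile X t) 0)%R)
    (EFin \o cst `|eta1 - eta2|%R)) => //.
    exact: integrable_quantile_excess.
  exact: integrable_cst_itv.
move=> t _; have := ler_norm (eta1 - eta2)%R; have := normr_ge0 (eta1 - eta2)%R.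
by case: (leP (eta1 - quantile X t)%R);
  case: (leP (eta2 - quantile X t)%R); lra.
Qed.

Lemma icdf_continuous X : L1 X -> continuous (fine \o icdf X).
Proof.
move=> hX x; apply/cvgrPdist_le => /= e e0; near=> y.
have xy : (`|x - y| <= e)%R by near: y; exact: cvgr_dist_le.
have := icdf_lipschitz x y hX; have := icdf_lipschitz y x hX.
rewrite (distrC y x) ler_norml; move: xy.
by set a := fine _; set b := fine _; lra.
Unshelve. all: end_near. Qed.

(** Intermediate values; this supplies the threshold c of the optimal Z. The level v has to be
    positive, since 0 may be only a limit at -oo. *)
Lemma icdf_surj X v : L1 X -> (0 < v)%R -> exists eta, icdf X eta = v%:E.
Proof.
move=> hX v0; have [a icdfa] := icdf_small hX v0.
have [b icdfb] := icdf_unbounded v hX.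
have := icdfb (Num.max a b); rewrite le_max lexx orbT => /(_ isT) icdfc.
have [|||eta _ icdf_eta] := @IVT _ (fine \o icdf X) a (Num.max a b) v.
- by rewrite le_max lexx.
- by apply: continuous_subspaceT; exact: icdf_continuous.
- move: icdfa icdfc; rewrite !icdfE// !lee_fin /= => va vc.
  by rewrite ge_min le_max icdfE//= va icdfE//= vc orbT.
- by exists eta; rewrite -icdf_eta /= fineK// icdfE.
Qed.

End Tails.

(** * The candidate max(X, c) *)

Section RaiseLowValues.
Context {d : measure_display} {T : measurableType d} {R : realType}
  {P : probability T R}.
Implicit Types (X Y Z : {RV P >-> R}) (p eta c : R).
Local Notation mu := (@lebesgue_measure R).

Definition max_RV X c : T -> R := fun w => Num.max (X w) c.

Let measurable_max_RV X c : measurable_fun [set: T] (max_RV X c).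
Proof. exact: measurable_maxr. Qed.

HB.instance Definition _ X c :=
  isMeasurableFun.Build _ _ _ _ (max_RV X c) (measurable_max_RV X c).

Lemma L1_max X c : L1 X -> L1 (max_RV X c : {RV P >-> R}).
Proof.
move=> /Lfun1_integrable iX; apply/Lfun1_integrable.
have ic : P.-integrable [set: T] (EFin \o cst `|c|%R).
  by apply/Lfun1_integrable; exact: Lfun_cst.
apply: le_integrable (integrableD _ (integrable_abse iX) ic) => //.
  by apply/measurable_EFinP; exact: measurable_max_RV.
move=> w _; rewrite /= lee_fin [leRHS]ger0_norm ?addr_ge0// /max_RV.
by case: (leP (X w) c) => _; rewrite ?lerDl ?lerDr.
Qed.

Lemma cdf_max X c eta :
  cdf (max_RV X c : {RV P >-> R}) eta = if (c <= eta)%R then cdf X eta else 0.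
Proof.
rewrite /cdf /distribution /pushforward /=; case: ifPn => c_eta.
  congr (P _); apply/seteqP; split => w /=;
    by rewrite !in_itv/= ge_max c_eta andbT.
rewrite (_ : _ @^-1` _ = set0) ?measure0//; apply/seteqP; split => w //=.
by rewrite in_itv/= ge_max (negbTE c_eta) andbF.
Qed.

Lemma fosd_max X c : fosd (max_RV X c : {RV P >-> R}) X.
Proof. by move=> eta; rewrite cdf_max; case: ifP. Qed.

Lemma quantile_max X c p : (0 < p < 1)%R ->
  quantile (max_RV X c : {RV P >-> R}) p = Num.max (quantile X p) c.
Proof.
move=> p01; have p0 : (p%:E <= 0) = false.
  by rewrite lee_fin; apply/negbTE; rewrite -ltNge; case/andP : p01.
(* Both numbers have the same upper bounds. An x < c is excluded on the left because the cdf of the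
   maximum vanishes there while p > 0. *)
have E x : (quantile (max_RV X c : {RV P >-> R}) p <= x)%R =
           (Num.max (quantile X p) c <= x)%R.
  rewrite quantile_le// cdf_max ge_max quantile_le//.
  by case: ifP; rewrite ?andbT ?andbF.
by apply/eqP; rewrite eq_le E lexx -E lexx.
Qed.

(** Pointwise, |max(q_X, c) - q_X| = (c - q_X)^+. *)
Lemma W1_max X c : W1 X (max_RV X c : {RV P >-> R}) = icdf X c.
Proof.
rewrite /W1 icdf_quantile; apply: eq_integral => p; rewrite inE/= in_itv/=.
move=> p01; rewrite quantile_max//; congr EFin.
case: (leP (quantile X p) c) => [qc|cq].
  by rewrite ger0_norm ?subr_ge0// max_l ?subr_ge0.
by rewrite subrr normr0 max_r// subr_le0 ltW.
Qed.

Lemma icdf_max_lt X c eta : (eta < c)%R ->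
  icdf (max_RV X c : {RV P >-> R}) eta = 0.
Proof.
move=> eta_c; apply: integral0_eq => t /=; rewrite in_itv/= => t_eta.
by rewrite cdf_max leNgt (le_lt_trans t_eta).
Qed.

(** Pointwise, (eta - max(q_X, c))^+ + (c - q_X)^+ = (eta - q_X)^+ when c <= eta. The additive form
    avoids subtracting possibly infinite values. *)
Lemma icdf_max_ge X c eta : (c <= eta)%R ->
  icdf (max_RV X c : {RV P >-> R}) eta + icdf X c = icdf X eta.
Proof.
move=> c_eta; rewrite !icdf_quantile -ge0_integralD//=.
2,3,4,5: try by [exact: measurable_quantile_excess|
                 move=> p _; rewrite lee_fin le_max lexx orbT].
apply: eq_integral => p; rewrite inE/= in_itv/= => p01.
rewrite quantile_max// -EFinD; congr EFin.
case: (leP (quantile X p) c) => [qc|cq].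
  rewrite !max_l ?subr_ge0//; last exact: le_trans c_eta.
  by rewrite subrKA.
by rewrite [X in (_ + X)%R]max_r ?addr0// subr_le0 ltW.
Qed.

End RaiseLowValues.

(** * Bounds on the distance and equality of the two suprema *)

Section Distance.
Context {d : measure_display} {T : measurableType d} {R : realType}
  {P : probability T R}.
Implicit Types (X Y Z : {RV P >-> R}) (p eta c : R).
Local Notation mu := (@lebesgue_measure R).

Let measurable_quantile_dist X Z :
  measurable_fun (`]0%R, 1%R[%classic : set R)
    (fun p => (`|quantile Z p - quantile X p|%R)%:E).
Proof.
apply/measurable_EFinP/measurableT_comp => //.
by apply: measurable_funB; exact: measurable_quantile.
Qed.

(** Serves to show that the common value of the problem is finite. *)
Lemma W1_lty X Z : L1 X -> L1 Z -> W1 X Z < +oo.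
Proof.
move=> hX hZ; apply: (@le_lt_trans _ _ (\int[mu]_(p in `]0%R, 1%R[)
  (`|(quantile Z p)%:E| + `|(quantile X p)%:E|))).
  apply: ge0_le_integral => //.
  - exact: measurable_quantile_dist.
  - apply: emeasurable_funD; apply/measurable_EFinP/measurableT_comp => //;
      exact: measurable_quantile.
  - by move=> p _; rewrite lee_fin ler_normB.
rewrite ge0_integralD//.
- have /integrableP[_ qX_lty] := integrable_quantile hX.
  have /integrableP[_ qZ_lty] := integrable_quantile hZ.
  exact: lte_add_pinfty qZ_lty qX_lty.
- by apply/measurable_EFinP/measurableT_comp => //; exact: measurable_quantile.
- by apply/measurable_EFinP/measurableT_comp => //; exact: measurable_quantile.
Qed.

Lemma W1_refl X : W1 X X = 0.
Proof. by apply: integral0_eq => p _; rewrite subrr normr0. Qed.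

(** Integrate (eta - x)^+ <= (eta - z)^+ + |z - x| along the quantile functions. *)
Lemma icdf_le_W1 X Z eta : icdf X eta <= icdf Z eta + W1 X Z.
Proof.
have mX := measurable_quantile_excess X eta.
have mZ := measurable_quantile_excess Z eta.
have mW := measurable_quantile_dist X Z.
rewrite !icdf_quantile /W1 -ge0_integralD//; last first.
  by move=> p _; rewrite lee_fin le_max lexx orbT.
apply: ge0_le_integral => //.
- by move=> p _; rewrite lee_fin le_max lexx orbT.
- exact: emeasurable_funD.
move=> p _; rewrite -EFinD lee_fin.
have := ler_norm (quantile Z p - quantile X p).
case: (leP (eta - quantile X p)%R); case: (leP (eta - quantile Z p)%R);
  have := normr_ge0 (quantile Z p - quantile X p)%R; lra.
Qed.

Lemma icdf_fin_num X eta : L1 X -> icdf X eta \is a fin_num.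
Proof. by move=> hX; rewrite icdfE. Qed.

Lemma iquantile_fin_num X p : L1 X -> (p <= 1)%R ->
  iquantile X p \is a fin_num.
Proof. by move=> hX p1; rewrite iquantileE. Qed.

Lemma icdf_sub_le_W1 X Y Z eta : L1 Y -> sosd Z Y ->
  icdf X eta - icdf Y eta <= W1 X Z.
Proof.
move=> hY ZY; rewrite leeBlDl ?icdf_fin_num//.
by apply: le_trans (icdf_le_W1 X Z eta) _; rewrite leeD2r.
Qed.

Local Notation primal X Y :=
  (maxe 0 (ereal_sup [set icdf X eta - icdf Y eta | eta in [set: R]])).

Local Notation dual X Y :=
  (maxe 0 (ereal_sup [set iquantile Y p - iquantile X p | p in `]0%R, 1%R]])).

(** For <=, given p, take eta nearly optimal for [Y] and combine with Fenchel-Young for [X]. For >=,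
    given eta, take p = F_X(eta), which gives equality for [X], and combine with Fenchel-Young for
    [Y]. *)
Lemma dual_eq_primal X Y : L1 X -> L1 Y -> dual X Y = primal X Y.
Proof.
move=> hX hY; apply/eqP; rewrite eq_le; apply/andP; split.
  rewrite ge_max le_max lexx /=; apply: ge_ereal_sup => _ [p + <-].
  rewrite /= in_itv/= => p01; apply/lee_addgt0Pr => e e0.
  have [eta] := fenchel_young_approx hY p01 e0.
  have := fenchel_young eta hX p01.
  have : icdf X eta - icdf Y eta <= primal X Y.
    by rewrite le_max ereal_sup_ubound ?orbT//; exists eta.
  have p1 : (p <= 1)%R by case/andP : p01.
  move=> le_sup yX yY; apply: le_trans (leeD2r _ le_sup).
  have /EFin_fin_numP[hx Ehx] := icdf_fin_num eta hX.
  have /EFin_fin_numP[hy Ehy] := icdf_fin_num eta hY.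
  have /EFin_fin_numP[gx Egx] := iquantile_fin_num hX p1.
  have /EFin_fin_numP[gy Egy] := iquantile_fin_num hY p1.
  move: yX yY; rewrite Ehx Ehy Egx Egy -!EFinB -!EFinD !lee_fin.
  clear; lra.
rewrite ge_max le_max lexx /=; apply: ge_ereal_sup => _ [eta _ <-].
have Ffin : cdf X eta \is a fin_num by rewrite fin_num_measure.
(* If F_X(eta) = 0, this p falls outside (0, 1]; but then F_X^(2)(eta) = 0, and the non-positive
   difference is absorbed by the maximum with 0. *)
have [F0|F0] := ltP 0%R (fine (cdf X eta)); last first.
  have -> : icdf X eta = 0.
    rewrite icdf_quantile; apply: integral0_eq => p; rewrite /= in_itv/= => p01.
    rewrite max_r// subr_le0 leNgt; apply/negP => /ltW.
    rewrite quantile_le// -(fineK Ffin) lee_fin leNgt.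
    by rewrite (le_lt_trans F0)//; case/andP : p01.
  by rewrite le_max sub0e oppe_le0 integral_ge0.
pose p := fine (cdf X eta).
have p01 : (0 < p <= 1)%R by rewrite F0 -lee_fin fineK// cdf_le1.
have p1 : (p <= 1)%R by case/andP : p01.
apply: (@le_trans _ _ (iquantile Y p - iquantile X p)); last first.
  by rewrite le_max ereal_sup_ubound ?orbT//; exists p => //=; rewrite in_itv.
have yY := fenchel_young eta hY p01.
have q_le t : t \in `]0%R, 1%R[ -> (quantile X t <= eta)%R = (t <= p)%R.
  by rewrite in_itv/= => t01; rewrite quantile_le// -(fineK Ffin).
have yX : icdf X eta + iquantile X p = (p * eta)%:E.
  apply: fenchel_young_eq => // t t01; first by rewrite q_le.
  by rewrite ltNge -q_le// -ltNge => /ltW.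
have /EFin_fin_numP[hx Ehx] := icdf_fin_num eta hX.
have /EFin_fin_numP[hy Ehy] := icdf_fin_num eta hY.
have /EFin_fin_numP[gx Egx] := iquantile_fin_num hX p1.
have /EFin_fin_numP[gy Egy] := iquantile_fin_num hY p1.
move: yX yY.
rewrite Ehx Ehy Egx Egy -!EFinB -!EFinD !lee_fin => -[].
clear; lra.
Qed.

Lemma primal_le_W1 X Y Z : L1 Y -> sosd Z Y -> primal X Y <= W1 X Z.
Proof.
move=> hY ZY; rewrite ge_max integral_ge0 => [|p _]; last by rewrite lee_fin.
by apply: ge_ereal_sup => _ [eta _ <-]; exact: icdf_sub_le_W1.
Qed.

Lemma exists_sosd_fosd_W1 X Y : L1 X -> L1 Y ->
  exists Z : {RV P >-> R}, [/\ L1 Z, sosd Z Y, fosd Z X & W1 X Z = primal X Y].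
Proof.
move=> hX hY; set M := primal X Y.
have M_ge eta : icdf X eta - icdf Y eta <= M.
  by rewrite le_max ereal_sup_ubound ?orbT//; exists eta.
have M0 : 0 <= M by rewrite le_max lexx.
have M_fin : M \is a fin_num.
  (* [Y] dominates itself, so M is at most the finite distance [W1 X Y]. *)
  rewrite ge0_fin_numE//; apply: le_lt_trans (W1_lty hX hY).
  exact: primal_le_W1.
(* If M = 0, [X] is itself feasible at distance 0, whereas a c with F_X^(2)(c) = 0 need not
   exist. *)
have [M_pos|M_le0] := ltP 0 M; last first.
  have M_eq0 : M = 0 by apply/eqP; rewrite eq_le M_le0.
  exists X; split => //; last by rewrite W1_refl.
  by move=> eta; have := M_ge eta; rewrite M_eq0 leeBlDr ?add0e ?icdf_fin_num.
have [c icdf_c] : exists c, icdf X c = (fine M)%:E.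
  by apply: icdf_surj => //; rewrite -lte_fin fineK.
rewrite fineK// in icdf_c.
exists (max_RV X c); split; [exact: L1_max| |exact: fosd_max|].
  move=> eta; have [eta_c|c_eta] := ltP eta c.
    by rewrite icdf_max_lt// integral_ge0.
  have := M_ge eta; rewrite -(icdf_max_ge X c_eta) icdf_c.
  by rewrite leeBlDr ?icdf_fin_num// addeC leeD2lE.
by rewrite W1_max.
Qed.

End Distance.

(** * The distance formula *)

Theorem theorem6 (d : measure_display) (T : measurableType d) (R : realType)
    (P : probability T R) (hP : atomless P) (X Y : {RV P >-> R})
    (hX : L1 X) (hY : L1 Y) :
  [/\ ereal_inf [set W1 X Z | Z in [set Z | [/\ L1 Z, sosd Z Y & fosd Z X]]]
        = dist X (A2 Y),
      dist X (A2 Y)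
        = maxe 0 (ereal_sup
            [set iquantile Y p - iquantile X p | p in `]0%R, 1%R]])
    & maxe 0 (ereal_sup
            [set iquantile Y p - iquantile X p | p in `]0%R, 1%R]])
        = maxe 0 (ereal_sup
            [set icdf X eta - icdf Y eta | eta in [set: R]])].
Proof.
have [Z [L1Z ZY ZX W1Z]] := exists_sosd_fosd_W1 hX hY.
set constrained := ereal_inf _.
(* The three inequalities close a cycle from the distance through the constrained infimum and
   [W1 X Z] back to the distance, so all three values agree. *)
have dist_le : dist X (A2 Y) <= constrained.
  by apply: le_ereal_inf => _ [Z' [L1Z' Z'Y _] <-]; exists Z'.
have constrained_le : constrained <= W1 X Z.
  by apply: ereal_inf_lbound; exists Z.
have le_dist : W1 X Z <= dist X (A2 Y).
  apply: le_ereal_inf_tmp => _ [Z' [_ Z'Y] <-]; rewrite W1Z.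
  exact: primal_le_W1.
have distE : dist X (A2 Y) = W1 X Z.
  by apply/eqP; rewrite eq_le le_dist (le_trans dist_le).
split; last exact: dual_eq_primal.
- by apply/eqP; rewrite eq_le dist_le distE constrained_le.
- by rewrite distE W1Z dual_eq_primal.
Qed.
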